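(* For every MAV structure $P$: if $P\longrightarrow^*\mathbf 1$ in MAV, then for every MAV-frame $F$ and every valuation $V$ of atoms in $\mathrm{Chu}(F)$, $I\sqsubseteq[\![P]\!]$ in $\mathrm{Chu}(F)$.
   Context: MAV syntax: structures $P ::= a \mid a^\perp \mid \mathbf{1} \mid P;Q \mid P\otimes Q \mid P⅋Q \mid P\& Q \mid P\oplus Q$ over a set of atoms, modulo the congruence making $(;,\mathbf 1)$ a monoid and $(\otimes,\mathbf 1),(⅋,\mathbf 1)$ commutative monoids; duality $(a)^\perp=a^\perp$, $(a^\perp)^\perp=a$, $\mathbf 1^\perp=\mathbf 1$, $(P\otimes Q)^\perp=P^\perp⅋Q^\perp$, $(P⅋Q)^\perp=P^\perp\otimes Q^\perp$, $(P;Q)^\perp=P^\perp;Q^\perp$, $(P\&Q)^\perp=P^\perp\oplus Q^\perp$, $(P\oplus Q)^\perp=P^\perp\&Q^\perp$. $P\longrightarrow Q$ is the least relation closed under one-hole contexts ($P\to Q$ implies $C[P]\to C[Q]$) containing: $P⅋P^\perp\to\mathbf 1$; $(P\otimes Q)⅋R\to P\otimes(Q⅋R)$; $\mathbf 1\&\mathbf 1\to\mathbf 1$; $(P;Q)⅋(R;S)\to(P⅋R);(Q⅋S)$; $P\oplus Q\to P$; $P\oplus Q\to Q$; $(P\&Q)⅋R\to(P⅋R)\&(Q⅋R)$; $(P;Q)\&(R;S)\to(P\&R);(Q\&S)$; $\mathbf 1\to P\otimes P^\perp$; $\mathbf 1\to\mathbf 1\oplus\mathbf 1$; $(P\otimes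 R);(Q\otimes S)\to(P;Q)\otimes(R;S)$; $P\to P\&Q$; $Q\to P\&Q$; $(P\otimes R)\oplus(Q\otimes R)\to(P\oplus Q)\otimes R$; $(P\oplus R);(Q\oplus S)\to(P;Q)\oplus(R;S)$. $\longrightarrow^*$ is its reflexive–transitive closure. An MAV-frame is $(F,\le,⅋,\lhd,i,+)$: poset, commutative pomonoid $(⅋,i)$, pomonoid $(\lhd,i)$ (operations monotone), monotone binary $+$, with $(w\lhd x)⅋(y\lhd z)\le(w⅋y)\lhd(x⅋z)$, $(x+y)⅋z\le(x⅋z)+(y⅋z)$, $(w\lhd x)+(y\lhd z)\le(w+y)\lhd(x+z)$, $i+i\le i$. $\mathrm{Chu}(F)$: with $\eta(x)=\{y\mid y\le x\}$, $\alpha(X)=\{x\mid x\le$ some finite $+$-combination of elements of $X\}$, $\mathcal C(F)$ the $+$-closed down-closed subsets, $X\vee Y=\alpha(X\cup Y)$, $K=\eta(i)$, $X\circledast Y=\alpha(\{z\mid z\le x⅋y,x\in X,y\in Y\})$, $X\hat\lhd Y=\{z\mid z\le x\lhd y,x\in X,y\in Y\}$, $X\multimap Y=\{z\mid\forall x\in X,\ z⅋x\in Y\}$; elements are pairs $(X^+,X^-)\in\mathcal C(F)^2$ with $X^+\circledast X^-\subseteq K$, ordered by $X\sqsubseteq Y$ iff $X^+\subseteq Y^+$ and $Y^-\subseteq X^-$; $X\otimes Y=(X^+\circledast Y^+,(Y^+\multimap X^-)\cap(X^+\multimap Y^-))$, $I=(K,K)$, $\neg(X^+,X^-)=(X^-,X^+)$,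 $X\lhd Y=(X^+\hat\lhd Y^+,X^-\hat\lhd Y^-)$, $X\&Y=(X^+\cap Y^+,X^-\vee Y^-)$. Interpretation given valuation $V$: $[\![\mathbf 1]\!]=I$, $[\![a]\!]=V(a)$, $[\![a^\perp]\!]=\neg V(a)$, $[\![P\otimes Q]\!]=[\![P]\!]\otimes[\![Q]\!]$, $[\![P⅋Q]\!]=\neg(\neg[\![P]\!]\otimes\neg[\![Q]\!])$, $[\![P;Q]\!]=[\![P]\!]\lhd[\![Q]\!]$, $[\![P\&Q]\!]=[\![P]\!]\&[\![Q]\!]$, $[\![P\oplus Q]\!]=\neg(\neg[\![P]\!]\&\neg[\![Q]\!])$. *)

(* Defs.v *)
From Stdlib Require Export Relations Ensembles.
From Stdlib Require Import Constructive_sets.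

Set Implicit Arguments.
Unset Strict Implicit.

(** [Structure A] is the raw syntax; the identification of structures up to
    the monoid laws is the relation [cong] below. *)
Inductive Structure (A : Type) : Type :=
| Atom (a : A)
| NAtom (a : A)
| One
| Seq (P Q : Structure A)
| Tensor (P Q : Structure A)
| Par (P Q : Structure A)
| With (P Q : Structure A)
| Plus (P Q : Structure A).

Arguments One {A}.

Declare Scope mav_scope.
Delimit Scope mav_scope with mav.
Bind Scope mav_scope with Structure.

Notation "1" := One : mav_scope.
Notation "P ⨾ Q" := (Seq P Q) (at level 40, left associativity) : mav_scope.
Notation "P ⊗ Q" := (Tensor P Q) (at level 40, left associativity) : mav_scope.
Notation "P ⅋ Q" := (Par P Q) (at level 40, left associativity) : mav_scope.
Notation "P && Q" := (With P Q) : mav_scope.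
Notation "P ⊕ Q" := (Plus P Q) (at level 40, left associativity) : mav_scope.

Local Open Scope mav_scope.

Fixpoint dual (A : Type) (P : Structure A) : Structure A :=
  match P with
  | Atom a => NAtom a
  | NAtom a => Atom a
  | 1 => 1
  | P ⨾ Q => dual P ⨾ dual Q
  | P ⊗ Q => dual P ⅋ dual Q
  | P ⅋ Q => dual P ⊗ dual Q
  | P && Q => dual P ⊕ dual Q
  | P ⊕ Q => dual P && dual Q
  end.

Inductive Ctx (A : Type) : Type :=
| Hole
| SeqL (C : Ctx A) (Q : Structure A)
| SeqR (P : Structure A) (C : Ctx A)
| TensorL (C : Ctx A) (Q : Structure A)
| TensorR (P : Structure A) (C : Ctx A)
| ParL (C : Ctx A) (Q : Structure A)
| ParR (P : Structure A) (C : Ctx A)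
| WithL (C : Ctx A) (Q : Structure A)
| WithR (P : Structure A) (C : Ctx A)
| PlusL (C : Ctx A) (Q : Structure A)
| PlusR (P : Structure A) (C : Ctx A).

Fixpoint fill (A : Type) (C : Ctx A) (R : Structure A) : Structure A :=
  match C with
  | Hole _ => R
  | SeqL C Q => fill C R ⨾ Q
  | SeqR P C => P ⨾ fill C R
  | TensorL C Q => fill C R ⊗ Q
  | TensorR P C => P ⊗ fill C R
  | ParL C Q => fill C R ⅋ Q
  | ParR P C => P ⅋ fill C R
  | WithL C Q => fill C R && Q
  | WithR P C => P && fill C R
  | PlusL C Q => fill C R ⊕ Q
  | PlusR P C => P ⊕ fill C R
  end.

Inductive cong (A : Type) : relation (Structure A) :=
| cong_refl P : cong P P
| cong_sym P Q : cong P Q -> cong Q P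
| cong_trans P Q R : cong P Q -> cong Q R -> cong P R
| cong_ctx C P Q : cong P Q -> cong (fill C P) (fill C Q)
| cong_seq_assoc P Q R : cong (P ⨾ (Q ⨾ R)) ((P ⨾ Q) ⨾ R)
| cong_seq_unitl P : cong (1 ⨾ P) P
| cong_seq_unitr P : cong (P ⨾ 1) P
| cong_tensor_assoc P Q R : cong (P ⊗ (Q ⊗ R)) ((P ⊗ Q) ⊗ R)
| cong_tensor_comm P Q : cong (P ⊗ Q) (Q ⊗ P)
| cong_tensor_unit P : cong (P ⊗ 1) P
| cong_par_assoc P Q R : cong (P ⅋ (Q ⅋ R)) ((P ⅋ Q) ⅋ R)
| cong_par_comm P Q : cong (P ⅋ Q) (Q ⅋ P)
| cong_par_unit P : cong (P ⅋ 1) P.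

Reserved Notation "P ⟶ Q" (at level 70, no associativity).

Inductive step (A : Type) : relation (Structure A) :=
| step_cong P P' Q' Q : cong P P' -> P' ⟶ Q' -> cong Q' Q -> P ⟶ Q
| step_ctx C P Q : P ⟶ Q -> fill C P ⟶ fill C Q
| step_interact P : P ⅋ dual P ⟶ 1
| step_switch P Q R : (P ⊗ Q) ⅋ R ⟶ P ⊗ (Q ⅋ R)
| step_tidy : 1 && 1 ⟶ 1
| step_seq P Q R S : (P ⨾ Q) ⅋ (R ⨾ S) ⟶ (P ⅋ R) ⨾ (Q ⅋ S)
| step_left P Q : P ⊕ Q ⟶ P
| step_right P Q : P ⊕ Q ⟶ Q
| step_external P Q R : (P && Q) ⅋ R ⟶ (P ⅋ R) && (Q ⅋ R)
| step_medial P Q R S : (P ⨾ Q) && (R ⨾ S) ⟶ (P && R) ⨾ (Q && S)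
| step_cointeract P : 1 ⟶ P ⊗ dual P
| step_cotidy : 1 ⟶ 1 ⊕ 1
| step_coseq P Q R S : (P ⊗ R) ⨾ (Q ⊗ S) ⟶ (P ⨾ Q) ⊗ (R ⨾ S)
| step_coleft P Q : P ⟶ P && Q
| step_coright P Q : Q ⟶ P && Q
| step_coexternal P Q R : (P ⊗ R) ⊕ (Q ⊗ R) ⟶ (P ⊕ Q) ⊗ R
| step_comedial P Q R S : (P ⊕ R) ⨾ (Q ⊕ S) ⟶ (P ⨾ Q) ⊕ (R ⨾ S)
where "P ⟶ Q" := (step P Q) : mav_scope.

(** The reflexive–transitive closure on structures modulo [cong]: on
    representatives, a zero-step reduction is an instance of [cong]. *)
Definition steps (A : Type) : relation (Structure A) :=
  clos_refl_trans (Structure A) (union (Structure A) (@cong A) (@step A)).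

Notation "P ⟶* Q" := (steps P Q) (at level 70, no associativity) : mav_scope.

Record MAVFrame : Type := {
  carrier :> Type;
  le : relation carrier;
  fpar : carrier -> carrier -> carrier;
  fseq : carrier -> carrier -> carrier;
  funit : carrier;
  fplus : carrier -> carrier -> carrier;
  le_order : order carrier le;
  fpar_mono : forall x x' y y', le x x' -> le y y' -> le (fpar x y) (fpar x' y');
  fpar_assoc : forall x y z, fpar x (fpar y z) = fpar (fpar x y) z;
  fpar_comm : forall x y, fpar x y = fpar y x;
  fpar_unit : forall x, fpar x funit = x;
  fseq_mono : forall x x' y y', le x x' -> le y y' -> le (fseq x y) (fseq x' y');
  fseq_assoc : forall x y z, fseq x (fseq y z) = fseq (fseq x y) z;
  fseq_unitl : forall x, fseq funit x = x;
  fseq_unitr : forall x, fseq x funit = x;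
  fplus_mono : forall x x' y y', le x x' -> le y y' -> le (fplus x y) (fplus x' y');
  fpar_fseq : forall w x y z,
    le (fpar (fseq w x) (fseq y z)) (fseq (fpar w y) (fpar x z));
  fpar_fplus : forall x y z,
    le (fpar (fplus x y) z) (fplus (fpar x z) (fpar y z));
  fplus_fseq : forall w x y z,
    le (fplus (fseq w x) (fseq y z)) (fseq (fplus w y) (fplus x z));
  fplus_funit : le (fplus funit funit) funit
}.

Arguments le {m}.
Arguments fpar {m}.
Arguments fseq {m}.
Arguments funit {m}.
Arguments fplus {m}.

Declare Scope frame_scope.
Delimit Scope frame_scope with frame.
Notation "x <= y" := (le x y) : frame_scope.
Notation "x ⅋ y" := (fpar x y) (at level 40, left associativity) : frame_scope.
Notation "x ◁ y" := (fseq x y) (at level 40, left associativity) : frame_scope.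
Notation "x + y" := (fplus x y) : frame_scope.
Notation "x ∈ X" := (In _ X x) (at level 70, no associativity) : frame_scope.

Lemma le_refl (F : MAVFrame) (x : F) : le x x.
Proof. apply (ord_refl _ _ (le_order F)). Qed.

Lemma le_trans (F : MAVFrame) (x y z : F) : le x y -> le y z -> le x z.
Proof. apply (ord_trans _ _ (le_order F)). Qed.

Section Chu.

Variable F : MAVFrame.
Local Open Scope frame_scope.

Record CSet : Type := {
  cset :> Ensemble F;
  cset_down : forall x y, x <= y -> y ∈ cset -> x ∈ cset;
  cset_plus : forall x y, x ∈ cset -> y ∈ cset -> (x + y) ∈ cset
}.

(** Finite [+]-combinations. A frame has no neutral element for [+], and [+]
    need not be associative, so these are nonempty binary trees. *)
Inductive comb (X : Ensemble F) : Ensemble F :=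
| comb_in x : x ∈ X -> comb X x
| comb_plus x y : comb X x -> comb X y -> comb X (x + y).

Definition alpha_set (X : Ensemble F) : Ensemble F :=
  fun x => exists y, y ∈ comb X /\ x <= y.

Definition alpha (X : Ensemble F) : CSet.
Proof.
  refine {| cset := alpha_set X |}.
  - intros x y hxy [z [hz hyz]]. exists z. eauto using le_trans.
  - intros x y [x' [hx hxx']] [y' [hy hyy']].
    exists (x' + y'). split; [now constructor | now apply fplus_mono].
Defined.

Definition eta (x : F) : Ensemble F := fun y => y <= x.

Definition K : CSet.
Proof.
  refine {| cset := eta funit |}; unfold eta.
  - intros x y; apply le_trans.
  - intros x y hx hy. apply le_trans with (funit + funit); [now apply fplus_mono|].
    apply fplus_funit.
Defined.

Definition join (X Y : CSet) : CSet := alpha (Union F X Y).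

Definition meet (X Y : CSet) : CSet.
Proof.
  refine {| cset := Intersection F X Y |}.
  - intros x y hxy [hX hY]%Intersection_inv. split.
    + exact (cset_down hxy hX).
    + exact (cset_down hxy hY).
  - intros x y [hx1 hx2]%Intersection_inv [hy1 hy2]%Intersection_inv.
    split; now apply cset_plus.
Defined.

Definition cpar (X Y : CSet) : CSet :=
  alpha (fun z => exists x y, x ∈ X /\ y ∈ Y /\ z <= x ⅋ y).

Definition cseq (X Y : CSet) : CSet.
Proof.
  refine {| cset := fun z => exists x y, x ∈ X /\ y ∈ Y /\ z <= x ◁ y |}.
  - intros z z' hz [x [y [hx [hy hz']]]]. exists x, y. eauto using le_trans.
  - intros z z' [x [y [hx [hy hz]]]] [x' [y' [hx' [hy' hz']]]].
    exists (x + x'), (y + y').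
    split; [now apply cset_plus|]. split; [now apply cset_plus|].
    eapply le_trans; [apply fplus_mono; eassumption|]. apply fplus_fseq.
Defined.

Definition limpl (X Y : CSet) : CSet.
Proof.
  refine {| cset := fun z => forall x, x ∈ X -> (z ⅋ x) ∈ Y |}.
  - intros z z' hz h x hx. apply cset_down with (z' ⅋ x); [|auto].
    apply fpar_mono; [assumption | apply le_refl].
  - intros z z' h h' x hx. apply cset_down with (z ⅋ x + z' ⅋ x).
    + apply fpar_fplus.
    + apply cset_plus; auto.
Defined.

Record Chu : Type := {
  pos : CSet;
  neg : CSet;
  pos_neg : Included F (cpar pos neg) K
}.

Definition chu_le (X Y : Chu) : Prop :=
  Included F (pos X) (pos Y) /\ Included F (neg Y) (neg X).

Lemma alpha_least (X : Ensemble F) (Y : CSet) :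
  Included F X Y -> Included F (alpha X) Y.
Proof.
  intros h x [y [hy hxy]]. apply cset_down with y; [assumption|].
  clear x hxy. induction hy as [y hy | y z hy IHy hz IHz].
  - now apply h.
  - now apply cset_plus.
Qed.

Lemma cpar_le_K (X Y : CSet) :
  (forall x y, x ∈ X -> y ∈ Y -> x ⅋ y <= funit) -> Included F (cpar X Y) K.
Proof.
  intros h. apply alpha_least. intros z [x [y [hx [hy hz]]]].
  eapply le_trans; [eassumption | now apply h].
Qed.

Lemma chu_par (X : Chu) (x y : F) : x ∈ pos X -> y ∈ neg X -> x ⅋ y <= funit.
Proof.
  intros hx hy. apply (pos_neg (c := X)). exists (x ⅋ y).
  split; [|apply le_refl]. constructor. exists x, y. auto using le_refl.
Qed.

Lemma alpha_par_le_unit (X : Ensemble F) (y : F) :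
  (forall x, x ∈ X -> x ⅋ y <= funit) -> forall x, x ∈ alpha X -> x ⅋ y <= funit.
Proof.
  intros h x [x' [hx' hx]].
  apply le_trans with (x' ⅋ y); [apply fpar_mono; [exact hx | apply le_refl]|].
  clear x hx. induction hx' as [x hx | x x' hx IHx hx' IHx']; [auto|].
  eapply le_trans; [apply fpar_fplus|].
  exact (cset_plus (c := K) IHx IHx').
Qed.

Definition chu_unit : Chu.
Proof.
  refine {| pos := K; neg := K |}. apply cpar_le_K. intros x y hx hy.
  apply le_trans with (funit ⅋ funit); [now apply fpar_mono|].
  rewrite fpar_unit. apply le_refl.
Defined.

Definition chu_neg (X : Chu) : Chu.
Proof.
  refine {| pos := neg X; neg := pos X |}. apply cpar_le_K. intros x y hx hy.
  rewrite fpar_comm. now apply (chu_par (X := X)).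
Defined.

Definition chu_tensor (X Y : Chu) : Chu.
Proof.
  refine {| pos := cpar (pos X) (pos Y);
            neg := meet (limpl (pos Y) (neg X)) (limpl (pos X) (neg Y)) |}.
  apply cpar_le_K. intros z w hz [hX hY]%Intersection_inv.
  revert z hz. apply alpha_par_le_unit. intros z [x [y [hx [hy hz]]]].
  apply le_trans with (x ⅋ y ⅋ w); [apply fpar_mono; [exact hz | apply le_refl]|].
  rewrite <- fpar_assoc, (fpar_comm y w).
  apply (chu_par (X := X)); [exact hx | exact (hX y hy)].
Defined.

Definition chu_seq (X Y : Chu) : Chu.
Proof.
  refine {| pos := cseq (pos X) (pos Y); neg := cseq (neg X) (neg Y) |}.
  apply cpar_le_K. intros z w [x [y [hx [hy hz]]]] [x' [y' [hx' [hy' hw]]]].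
  apply le_trans with ((x ◁ y) ⅋ (x' ◁ y')); [now apply fpar_mono|].
  eapply le_trans; [apply fpar_fseq|].
  apply le_trans with (funit ◁ funit).
  - apply fseq_mono; [now apply (chu_par (X := X)) | now apply (chu_par (X := Y))].
  - rewrite fseq_unitl. apply le_refl.
Defined.

Definition chu_with (X Y : Chu) : Chu.
Proof.
  refine {| pos := meet (pos X) (pos Y); neg := join (neg X) (neg Y) |}.
  apply cpar_le_K. intros x z [hX hY]%Intersection_inv hz.
  rewrite fpar_comm. revert z hz. apply alpha_par_le_unit.
  intros z [hz | hz]%Union_inv; rewrite fpar_comm.
  - now apply (chu_par (X := X)).
  - now apply (chu_par (X := Y)).
Defined.

End Chu.

Fixpoint interp (A : Type) (F : MAVFrame) (V : A -> Chu F) (P : Structure A) :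
    Chu F :=
  match P with
  | Atom a => V a
  | NAtom a => chu_neg (V a)
  | 1 => chu_unit F
  | P ⨾ Q => chu_seq (interp V P) (interp V Q)
  | P ⊗ Q => chu_tensor (interp V P) (interp V Q)
  | P ⅋ Q => chu_neg (chu_tensor (chu_neg (interp V P)) (chu_neg (interp V Q)))
  | P && Q => chu_with (interp V P) (interp V Q)
  | P ⊕ Q => chu_neg (chu_with (chu_neg (interp V P)) (chu_neg (interp V Q)))
  end.

(* Main.v *)
Require Import Defs.
From Stdlib Require Import Constructive_sets Setoid.

(** Every step is sound read backwards: if [P ⟶ Q] then [⟦Q⟧ ⊑ ⟦P⟧]. Since
    [chu_neg] is an antitone involution with [X ⊗ Y ⊑ ¬ Z] iff [X ⊑ ¬ (Y ⊗ Z)],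
    [chu_with] is the binary meet, and [chu_seq] is self-dual and satisfies an
    interchange law with the tensor, each rule and its co-rule are instances of
    one inequality in [Chu F], possibly negated. *)

Section ChuAlgebra.

Variable F : MAVFrame.
Local Open Scope frame_scope.

Local Infix "⊑" := (@chu_le F) (at level 70, no associativity).
Local Infix "⊗" := (@chu_tensor F) (at level 40, left associativity).
Local Infix "⨾" := (@chu_seq F) (at level 40, left associativity).
Local Infix "&" := (@chu_with F) (at level 40, left associativity).
Local Notation "¬ X" := (chu_neg X) (at level 35, right associativity).
Local Notation I := (chu_unit F).

(** * Closed sets: products, units and joins *)

Lemma in_cpar (X Y : CSet F) x y : x ∈ X -> y ∈ Y -> (x ⅋ y) ∈ cpar X Y.
Proof.
  intros hx hy. exists (x ⅋ y). split; [|apply le_refl].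
  constructor. exists x, y. auto using le_refl.
Qed.

(** A closed target absorbs both the down-closure and the [+]-closure in [cpar], so only the
    generators [x ⅋ y] need checking. *)
Lemma cpar_least (X Y Z : CSet F) :
  (forall x y, x ∈ X -> y ∈ Y -> (x ⅋ y) ∈ Z) -> Included F (cpar X Y) Z.
Proof.
  intros h. apply alpha_least. intros z [x [y [hx [hy hz]]]].
  exact (cset_down hz (h _ _ hx hy)).
Qed.

Lemma in_cseq (X Y : CSet F) x y : x ∈ X -> y ∈ Y -> (x ◁ y) ∈ cseq X Y.
Proof. intros hx hy. exists x, y. auto using le_refl. Qed.

Lemma cseq_least (X Y Z : CSet F) :
  (forall x y, x ∈ X -> y ∈ Y -> (x ◁ y) ∈ Z) -> Included F (cseq X Y) Z.
Proof.
  intros h z [x [y [hx [hy hz]]]]. exact (cset_down hz (h _ _ hx hy)).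
Qed.

Lemma cseq_mono (X X' Y Y' : CSet F) :
  Included F X X' -> Included F Y Y' -> Included F (cseq X Y) (cseq X' Y').
Proof. intros h h'. apply cseq_least. intros x y hx hy. apply in_cseq; auto. Qed.

(** [cseq] is already [+]-closed without [alpha], so its elements have explicit factors that can be
    regrouped directly. *)
Lemma cseq_assoc (X Y Z : CSet F) :
  Same_set F (cseq X (cseq Y Z)) (cseq (cseq X Y) Z).
Proof.
  split; intros w [x [y [hx [hy hw]]]].
  - destruct hy as [y' [z [hy' [hz hy]]]]. exists (x ◁ y'), z.
    split; [now apply in_cseq|]. split; [assumption|].
    apply le_trans with (x ◁ y); [assumption|].
    rewrite <- fseq_assoc. apply fseq_mono; [apply le_refl | assumption].
  - destruct hx as [x' [z [hx' [hz hx]]]]. exists x', (z ◁ y).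
    split; [assumption|]. split; [now apply in_cseq|].
    apply le_trans with (x ◁ y); [assumption|].
    rewrite fseq_assoc. apply fseq_mono; [assumption | apply le_refl].
Qed.

Lemma cseq_K_l (X : CSet F) : Same_set F (cseq (K F) X) X.
Proof.
  split.
  - apply cseq_least. intros k x hk hx. apply cset_down with x; [|assumption].
    rewrite <- (fseq_unitl x) at 2. apply fseq_mono; [exact hk | apply le_refl].
  - intros x hx. exists funit, x. rewrite fseq_unitl.
    repeat split; [apply le_refl | assumption | apply le_refl].
Qed.

Lemma cseq_K_r (X : CSet F) : Same_set F (cseq X (K F)) X.
Proof.
  split.
  - apply cseq_least. intros x k hx hk. apply cset_down with x; [|assumption].
    rewrite <- (fseq_unitr x) at 2. apply fseq_mono; [apply le_refl | exact hk].
  - intros x hx. exists x, funit. rewrite fseq_unitr.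
    repeat split; [assumption | apply le_refl | apply le_refl].
Qed.

Lemma par_K (X : CSet F) x k : x ∈ X -> k ∈ K F -> (x ⅋ k) ∈ X.
Proof.
  intros hx hk. apply cset_down with x; [|assumption].
  rewrite <- (fpar_unit x) at 2. apply fpar_mono; [apply le_refl | exact hk].
Qed.

Lemma join_l (X Y : CSet F) : Included F X (join X Y).
Proof.
  intros x hx. exists x. split; [|apply le_refl].
  constructor. now apply Union_introl.
Qed.

Lemma join_r (X Y : CSet F) : Included F Y (join X Y).
Proof.
  intros x hx. exists x. split; [|apply le_refl].
  constructor. now apply Union_intror.
Qed.

(** * Order, tensor and negation on Chu elements *)

#[local] Instance chu_le_preorder : PreOrder (@chu_le F).
Proof.
  split.
  - intros X. split; intros x hx; exact hx.
  - intros X Y Z [h1 h2] [h3 h4]. split; intros x hx; auto.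
Qed.

Lemma neg_mono X Y : X ⊑ Y -> ¬ Y ⊑ ¬ X.
Proof. intros [h h']. now split. Qed.

Lemma tensor_mono_l X X' Y : X ⊑ X' -> X ⊗ Y ⊑ X' ⊗ Y.
Proof.
  intros [h h']. split.
  - apply cpar_least. intros x y hx hy. apply in_cpar; auto.
  - intros w [hw1 hw2]%Intersection_inv. split; intros v hv.
    + apply h'. now apply hw1.
    + apply hw2. now apply h.
Qed.

Lemma tensor_comm X Y : X ⊗ Y ⊑ Y ⊗ X.
Proof.
  split.
  - apply cpar_least. intros x y hx hy. rewrite fpar_comm. now apply in_cpar.
  - intros w [hw1 hw2]%Intersection_inv. now split.
Qed.

Lemma tensor_mono_r X Y Y' : Y ⊑ Y' -> X ⊗ Y ⊑ X ⊗ Y'.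
Proof.
  intros h. rewrite (tensor_comm X Y), <- (tensor_comm Y' X).
  now apply tensor_mono_l.
Qed.

Lemma tensor_assoc X Y Z : X ⊗ Y ⊗ Z ⊑ X ⊗ (Y ⊗ Z).
Proof.
  split.
  - set (T := cpar (pos X) (cpar (pos Y) (pos Z))).
    (* Residuating [pos Z] away leaves a closed target, so [cpar_least] reduces the compound factor
       to generators [x ⅋ y]. *)
    enough (h : Included F (cpar (pos X) (pos Y)) (limpl (pos Z) T)).
    { apply (cpar_least _ _ T). intros p z hp. now apply h. }
    apply cpar_least. intros x y hx hy z hz. rewrite <- fpar_assoc.
    apply in_cpar; [assumption | now apply in_cpar].
  - intros w [hw1 hw2]%Intersection_inv. split.
    + intros z hz. split.
      * intros y hy. rewrite <- fpar_assoc, (fpar_comm z). apply hw1.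
        now apply in_cpar.
      * intros x hx. rewrite <- fpar_assoc, (fpar_comm z), fpar_assoc.
        specialize (hw2 x hx). apply Intersection_inv in hw2 as [hw2 _].
        now apply hw2.
    (* Here [p] lies in a closure; moving [w] into a residual makes the set of admissible [p]
       closed, so again generators suffice. *)
    + intros p hp. rewrite fpar_comm. revert w hw1 hw2.
      enough (h : p ∈ limpl (neg (X ⊗ (Y ⊗ Z))) (neg Z)).
      { intros w hw1 hw2. apply h. now split. }
      revert p hp. apply cpar_least.
      intros x y hx hy w [_ hw2]%Intersection_inv.
      rewrite fpar_comm, fpar_assoc.
      specialize (hw2 x hx). apply Intersection_inv in hw2 as [_ hw2].
      now apply hw2.
Qed.

(** The converse comes from [tensor_assoc] by cyclic rotation of the three factors. *)
Lemma tensor_assoc_sym X Y Z : X ⊗ (Y ⊗ Z) ⊑ X ⊗ Y ⊗ Z.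
Proof.
  rewrite (tensor_comm X (Y ⊗ Z)), (tensor_assoc Y Z X).
  rewrite (tensor_comm Y (Z ⊗ X)), (tensor_assoc Z X Y).
  apply tensor_comm.
Qed.

Lemma tensor_unit X : X ⊗ I ⊑ X.
Proof.
  split.
  - apply cpar_least. intros x k. apply par_K.
  - intros w hw. split; intros x hx.
    + now apply par_K.
    (* The component [pos X ⊸ K] holds because [X] is orthogonal to its own negative part. *)
    + rewrite fpar_comm. now apply (chu_par (X := X)).
Qed.

Lemma tensor_unit_sym X : X ⊑ X ⊗ I.
Proof.
  split.
  - intros x hx. rewrite <- (fpar_unit x).
    apply in_cpar; [assumption | apply le_refl].
  - intros w [hw _]%Intersection_inv. rewrite <- (fpar_unit w).
    apply hw, le_refl.
Qed.

(** Both sides unfold to the same three conditions: the product of the positive parts of any two of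
    [X], [Y], [Z] lies in the negative part of the third. *)
Lemma curry X Y Z : X ⊗ Y ⊑ ¬ Z -> X ⊑ ¬ (Y ⊗ Z).
Proof.
  intros [h h']. split.
  - intros x hx. split.
    + intros z hz. specialize (h' z hz).
      apply Intersection_inv in h' as [_ h']. rewrite fpar_comm. now apply h'.
    + intros y hy. apply h. now apply in_cpar.
  - apply cpar_least. intros y z hy hz. specialize (h' z hz).
    apply Intersection_inv in h' as [h' _]. rewrite fpar_comm. now apply h'.
Qed.

Lemma neg_swap X Y : X ⊑ ¬ Y -> Y ⊑ ¬ X.
(* [chu_le] inspects only [pos] and [neg], so [¬ ¬ Y] may stand for [Y] by conversion. *)
Proof. exact (neg_mono X (¬ Y)). Qed.

(** The condition is cyclic in [X], [Y], [Z]: two more rotations by [curry] return to the start. *)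
Lemma uncurry X Y Z : X ⊑ ¬ (Y ⊗ Z) -> X ⊗ Y ⊑ ¬ Z.
Proof. intros h. now apply neg_swap, curry, neg_swap, curry, neg_swap. Qed.

Lemma tensor_neg X : X ⊗ ¬ X ⊑ I.
Proof.
  split.
  - apply pos_neg.
  - intros k hk. split; intros x hx; rewrite fpar_comm; now apply par_K.
Qed.

(** * Sequencing, meets and the inequalities behind the rules *)

Lemma seq_mono X X' Y Y' : X ⊑ X' -> Y ⊑ Y' -> X ⨾ Y ⊑ X' ⨾ Y'.
Proof. intros [h h'] [k k']. split; now apply cseq_mono. Qed.

Lemma with_l X Y : X & Y ⊑ X.
Proof. split; [now intros x [hx _]%Intersection_inv | apply join_l]. Qed.

Lemma with_r X Y : X & Y ⊑ Y.
Proof. split; [now intros x [_ hx]%Intersection_inv | apply join_r]. Qed.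

Lemma with_glb X Y Z : Z ⊑ X -> Z ⊑ Y -> Z ⊑ X & Y.
Proof.
  intros [h h'] [k k']. split.
  - intros x hx. split; auto.
  - apply alpha_least. intros x [hx | hx]%Union_inv; auto.
Qed.

Lemma with_mono X X' Y Y' : X ⊑ X' -> Y ⊑ Y' -> X & Y ⊑ X' & Y'.
Proof.
  intros h k. apply with_glb; [rewrite <- h; apply with_l |
    rewrite <- k; apply with_r].
Qed.

(** The frame law [fpar_fseq] serves both halves: on positive parts for products, on negative parts
    for each residual. *)
Lemma tensor_seq W X Y Z : (W ⨾ X) ⊗ (Y ⨾ Z) ⊑ (W ⊗ Y) ⨾ (X ⊗ Z).
Proof.
  split.
  - apply cpar_least.
    intros p q [w [x [hw [hx hp]]]] [y [z [hy [hz hq]]]].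
    exists (w ⅋ y), (x ⅋ z). split; [now apply in_cpar|].
    split; [now apply in_cpar|].
    eapply le_trans; [apply fpar_mono; eassumption | apply fpar_fseq].
  - intros t [u [v [hu [hv ht]]]].
    apply Intersection_inv in hu as [hu1 hu2], hv as [hv1 hv2].
    split; intros p [a [b [ha [hb hp]]]]; exists (u ⅋ a), (v ⅋ b);
      (split; [auto|]; split; [auto|];
       eapply le_trans; [apply fpar_mono; eassumption | apply fpar_fseq]).
Qed.

(** Transposing [¬ Z] to the left turns the claim into evaluation, [(Y ⅋ Z) ⊗ ¬ Z ⊑ Y], tensored
    with [X]. *)
Lemma switch X Y Z : X ⊗ ¬ (¬ Y ⊗ ¬ Z) ⊑ ¬ (¬ (X ⊗ Y) ⊗ ¬ Z).
Proof.
  rewrite <- (neg_mono _ _ (tensor_comm (¬ (X ⊗ Y)) (¬ Z))).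
  apply curry. change (X ⊗ ¬ (¬ Y ⊗ ¬ Z) ⊗ ¬ Z ⊑ X ⊗ Y).
  rewrite (tensor_assoc X _ (¬ Z)). apply tensor_mono_r.
  apply (uncurry (¬ (¬ Y ⊗ ¬ Z)) (¬ Z) (¬ Y)).
  apply neg_mono, tensor_comm.
Qed.

(** Par with [Z] is right adjoint to tensoring with [¬ Z], hence preserves meets. *)
Lemma external X Y Z :
  ¬ (¬ X ⊗ ¬ Z) & ¬ (¬ Y ⊗ ¬ Z) ⊑ ¬ (¬ (X & Y) ⊗ ¬ Z).
Proof.
  rewrite <- (neg_mono _ _ (tensor_comm (¬ (X & Y)) (¬ Z))).
  (* [&] and [⊗] share a precedence level: the left side is the whole meet tensored with [¬ Z]. *)
  apply curry. change (¬ (¬ X ⊗ ¬ Z) & ¬ (¬ Y ⊗ ¬ Z) ⊗ ¬ Z ⊑ X & Y).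
  apply with_glb.
  - rewrite (tensor_mono_l _ _ (¬ Z) (with_l _ _)).
    apply (uncurry _ (¬ Z) (¬ X)), neg_mono, tensor_comm.
  - rewrite (tensor_mono_l _ _ (¬ Z) (with_r _ _)).
    apply (uncurry _ (¬ Z) (¬ Y)), neg_mono, tensor_comm.
Qed.

Lemma medial W X Y Z : (W & Y) ⨾ (X & Z) ⊑ (W ⨾ X) & (Y ⨾ Z).
Proof.
  apply with_glb; apply seq_mono; (apply with_l || apply with_r).
Qed.

(** * Monoid laws of [⨾] and monotonicity of the connectives *)

Lemma seq_assoc X Y Z : X ⨾ (Y ⨾ Z) ⊑ X ⨾ Y ⨾ Z.
Proof. split; apply cseq_assoc. Qed.

Lemma seq_assoc_sym X Y Z : X ⨾ Y ⨾ Z ⊑ X ⨾ (Y ⨾ Z).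
Proof. split; apply cseq_assoc. Qed.

Lemma seq_unit_l X : I ⨾ X ⊑ X.
Proof. split; apply cseq_K_l. Qed.

Lemma seq_unit_l_sym X : X ⊑ I ⨾ X.
Proof. split; apply cseq_K_l. Qed.

Lemma seq_unit_r X : X ⨾ I ⊑ X.
Proof. split; apply cseq_K_r. Qed.

Lemma seq_unit_r_sym X : X ⊑ X ⨾ I.
Proof. split; apply cseq_K_r. Qed.

Lemma tensor_mono X X' Y Y' : X ⊑ X' -> Y ⊑ Y' -> X ⊗ Y ⊑ X' ⊗ Y'.
Proof.
  intros h k. rewrite (tensor_mono_l _ _ Y h). now apply tensor_mono_r.
Qed.

Lemma par_mono X X' Y Y' :
  X ⊑ X' -> Y ⊑ Y' -> ¬ (¬ X ⊗ ¬ Y) ⊑ ¬ (¬ X' ⊗ ¬ Y').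
Proof. intros h k. now apply neg_mono, tensor_mono; apply neg_mono. Qed.

Lemma plus_mono X X' Y Y' :
  X ⊑ X' -> Y ⊑ Y' -> ¬ (¬ X & ¬ Y) ⊑ ¬ (¬ X' & ¬ Y').
Proof. intros h k. now apply neg_mono, with_mono; apply neg_mono. Qed.

(** * Soundness of congruence, steps and reductions *)

Section Soundness.

Variables (A : Type) (V : A -> Chu F).

Lemma interp_fill (C : Ctx A) (P Q : Structure A) :
  interp V P ⊑ interp V Q -> interp V (fill C P) ⊑ interp V (fill C Q).
Proof.
  intros h. induction C as [| | | | | | | | | |]; cbn;
    [assumption
    | apply seq_mono | apply seq_mono | apply tensor_mono | apply tensor_mono
    | apply par_mono | apply par_mono | apply with_mono | apply with_mono
    | apply plus_mono | apply plus_mono]; (assumption || reflexivity).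
Qed.

(** [¬ ¬ X] and [X] differ in their proof field but have convertible [pos] and
    [neg]; hence inequalities only, and [exact] up to double negation. *)
Lemma interp_dual (P : Structure A) :
  interp V (dual P) ⊑ ¬ interp V P /\ ¬ interp V P ⊑ interp V (dual P).
Proof.
  induction P as
    [a | a | | P [h h'] Q [k k'] | P [h h'] Q [k k'] | P [h h'] Q [k k']
    | P [h h'] Q [k k'] | P [h h'] Q [k k']]; cbn.
  1, 2, 3: split; split; intros x hx; exact hx.
  - split; [exact (seq_mono _ _ _ _ h k) | exact (seq_mono _ _ _ _ h' k')].
  - split; [exact (par_mono _ _ _ _ h k) | exact (par_mono _ _ _ _ h' k')].
  - split; [exact (tensor_mono _ _ _ _ h k) | exact (tensor_mono _ _ _ _ h' k')].
  - split; [exact (plus_mono _ _ _ _ h k) | exact (plus_mono _ _ _ _ h' k')].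
  - split; [exact (with_mono _ _ _ _ h k) | exact (with_mono _ _ _ _ h' k')].
Qed.

Lemma tensor_dual (P : Structure A) :
  interp V P ⊗ interp V (dual P) ⊑ I.
Proof.
  rewrite (tensor_mono_r (interp V P) _ _ (proj1 (interp_dual P))).
  apply tensor_neg.
Qed.

Lemma par_dual (P : Structure A) :
  I ⊑ ¬ (¬ interp V P ⊗ ¬ interp V (dual P)).
Proof.
  apply neg_swap.
  rewrite (tensor_mono_r (¬ interp V P) _ _
    (neg_mono _ _ (proj2 (interp_dual P)))).
  exact (tensor_neg (¬ interp V P)).
Qed.

(** Proving both inequalities at once lets the induction pass through [cong_sym]. *)
Lemma cong_sound (P Q : Structure A) :
  cong P Q -> interp V P ⊑ interp V Q /\ interp V Q ⊑ interp V P.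
Proof.
  induction 1 as
    [P | P Q _ [h h'] | P Q R _ [h h'] _ [k k'] | C P Q _ [h h'] | P Q R | P | P
    | P Q R | P Q | P | P Q R | P Q | P].
  - split; reflexivity.
  - now split.
  - split; [now rewrite h | now rewrite k'].
  - split; now apply interp_fill.
  - split; [apply seq_assoc | apply seq_assoc_sym].
  - split; [apply seq_unit_l | apply seq_unit_l_sym].
  - split; [apply seq_unit_r | apply seq_unit_r_sym].
  - split; [apply tensor_assoc_sym | apply tensor_assoc].
  - split; apply tensor_comm.
  - split; [apply tensor_unit | apply tensor_unit_sym].
  - split; apply neg_mono;
      [apply (tensor_assoc (¬ _) (¬ _) (¬ _))
      | apply (tensor_assoc_sym (¬ _) (¬ _) (¬ _))].
  - split; apply neg_mono, tensor_comm.
  - split; [apply (neg_mono _ _ (tensor_unit_sym (¬ interp V P)))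
           | apply (neg_mono _ _ (tensor_unit (¬ interp V P)))].
Qed.

Lemma step_sound (P Q : Structure A) : step P Q -> interp V Q ⊑ interp V P.
Proof.
  induction 1 as
    [P P' Q' Q hP _ IH hQ | C P Q _ IH | P | P Q R | | P Q R S | P Q | P Q | P Q R
    | P Q R S | P | | P Q R S | P Q | P Q | P Q R | P Q R S]; cbn.
  - rewrite (proj2 (cong_sound _ _ hQ)), IH. apply (cong_sound _ _ hP).
  - now apply interp_fill.
  - apply par_dual.
  - apply switch.
  - now apply with_glb.
  - exact (neg_mono _ _
      (tensor_seq (¬ interp V P) (¬ interp V Q) (¬ interp V R) (¬ interp V S))).
  - apply neg_swap, with_l.
  - apply neg_swap, with_r.
  - apply external.
  - apply medial.
  - apply tensor_dual.
  (* [I] agrees with [¬ ¬ I] in both components, so the goal is the negation of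
     [¬ I ⊑ ¬ I & ¬ I]. *)
  - apply (neg_mono (¬ I)). now apply with_glb.
  - apply tensor_seq.
  - apply with_l.
  - apply with_r.
  - exact (neg_mono _ _
      (external (¬ interp V P) (¬ interp V Q) (¬ interp V R))).
  - exact (neg_mono _ _
      (medial (¬ interp V P) (¬ interp V Q) (¬ interp V R) (¬ interp V S))).
Qed.

Lemma steps_sound (P Q : Structure A) : steps P Q -> interp V Q ⊑ interp V P.
Proof.
  induction 1 as [P Q [h | h] | P | P Q R _ IH _ IH'].
  - apply (cong_sound _ _ h).
  - now apply step_sound.
  - reflexivity.
  - now rewrite IH'.
Qed.

End Soundness.

End ChuAlgebra.

Theorem theorem3p49 (A : Type) (P : Structure A) (hP : steps P One)
    (F : MAVFrame) (V : A -> Chu F) :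
  chu_le (chu_unit F) (interp V P).
Proof. exact (steps_sound F A V P One hP). Qed.
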